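(* Let $p$ be an odd prime and let $G$ be a group with $|G|=p^n$ and $|Z(G)|=p^{n-2}$. Let $\Gamma=\zeta(G,G)$ be the commuting graph of $G$. Then the normalized Laplacian spectrum $\operatorname{Spec}_{\mathcal{L}}(\Gamma)$ is $$\left\{ 0,\ \frac{p^n(p^{n-1}+p^{n-2}-p^{n-3}-1)}{(p^n-1)(p^{n-1}-1)},\ \left(\frac{p^n}{p^n-1}\right)^{p^{n-2}-1},\ \left(\frac{p^{n-1}}{p^{n-1}-1}\right)^{p^{n}-p^{n-2}-p-1},\ \left(\frac{p^{n-2}}{p^{n-1}-1}\right)^{p}\right\},$$ where the exponents outside the parentheses denote multiplicities.
   Context: $Z(G)$ is the center of $G$. The commuting graph $\zeta(G,G)$ is the simple graph with vertex set $G$ in which two distinct vertices are adjacent if and only if they commute in $G$. For a graph $\Gamma$ with vertices $v_1,\dots,v_k$, the normalized Laplacian matrix $\mathcal{L}(\Gamma)=[l_{ij}]$ has $l_{ij}=1$ if $i=j$ and $\deg(v_i)\neq 0$; $l_{ij}=-1/\sqrt{\deg(v_i)\deg(v_j)}$ if $v_iv_j$ is an edge; and $l_{ij}=0$ otherwise. $\operatorname{Spec}_{\mathcal{L}}(\Gamma)$ is the spectrum of $\mathcal{L}(\Gamma)$, i.e. the multiset of its eigenvalues; $\{\lambda_1^{m_1},\dots,\lambda_k^{m_k}\}$ denotes the multiset in which $\lambda_i$ occurs with multiplicity $m_i$ (no exponent meaning multiplicity 1). *)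

(* Defs.v *)
From HB Require Import structures.
From mathcomp Require Import all_boot all_order all_algebra all_fingroup.

Set Implicit Arguments.
Unset Strict Implicit.
Unset Printing Implicit Defensive.

Import GRing.Theory Num.Theory.

Record sgraph (T : finType) := SGraph {
  edge : rel T;
  edge_sym : symmetric edge;
  edge_irrefl : irreflexive edge
}.

Definition deg (T : finType) (Gamma : sgraph T) (x : T) : nat :=
  #|[set y | edge Gamma x y]|.

Section CommutingGraph.
Variables (gT : finGroupType) (G : {group gT}).

Definition commuting_rel : rel (subg_of G) :=
  [rel x y | (x != y) && (x * y == y * x)%g].

Fact commuting_rel_sym : symmetric commuting_rel.
Proof. by move=> x y; rewrite /commuting_rel /= eq_sym [(x * y)%g == _]eq_sym. Qed.

Fact commuting_rel_irrefl : irreflexive commuting_rel.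
Proof. by move=> x; rewrite /commuting_rel /= eqxx. Qed.

Definition commuting_graph : sgraph (subg_of G) :=
  SGraph commuting_rel_sym commuting_rel_irrefl.

End CommutingGraph.

Local Open Scope ring_scope.

Definition normalized_laplacian (R : rcfType) (T : finType) (Gamma : sgraph T) :
    'M[R]_#|T| :=
  \matrix_(i, j)
    let x : T := enum_val i in let y : T := enum_val j in
    if (x == y) && (deg Gamma x != 0%N) then 1
    else if edge Gamma x y then
      - (1 / Num.sqrt ((deg Gamma x)%:R * (deg Gamma y)%:R))
    else 0.

(* The list [s] enumerates, in some order and with algebraic multiplicity, the
   eigenvalues of [A]; in particular all of them lie in [F]. *)
Definition is_spectrum (F : fieldType) (k : nat) (A : 'M[F]_k) (s : seq F) :
    Prop :=
  char_poly A = \prod_(a <- s) ('X - a%:P).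

(* Main.v *)
(* A noncentral element has a centralizer of order p^(n-1) in which Z(G) has
   index p, so this centralizer is abelian: the noncentral elements split into
   p + 1 cliques of equal size, each joined to every central element and to
   nothing else. If D is the degree matrix, D^(1/2) (X - L) D^(1/2) is then a
   diagonal matrix plus the 0-1 matrix of "commute", which has rank p + 2.
   The determinant is computed by two low-rank updates: first the disjoint
   cliques, then the two vectors that indicate the center and its complement,
   both of which are eigenvectors of the matrix obtained in the first step. *)
Require Import Defs.
From HB Require Import structures.
From mathcomp Require Import all_boot all_order all_algebra all_fingroup all_solvable.
From mathcomp Require Import ring zify.

Set Implicit Arguments.
Unset Strict Implicit.
Unset Printing Implicit Defensive.

Import GRing.Theory Num.Theory.
Local Open Scope ring_scope.


(** * Determinants of low-rank updates, and counting sums *)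

Lemma det_mx22 (A : comNzRingType) (M : 'M[A]_2) :
  \det M = M 0 0 * M 1 1 - M 0 1 * M 1 0.
Proof.
rewrite (expand_det_row M 0) !big_ord_recl big_ord0 addr0 /cofactor !det_mx11.
rewrite !mxE /= expr0 expr1 mul1r mulN1r mulrN.
by congr (M _ _ * M _ _ - M _ _ * M _ _); apply: val_inj.
Qed.

(* A form of the matrix determinant lemma that needs no inverse of [B], hence
   applies over a polynomial ring. *)
Lemma det_add_mulmx (A : comNzRingType) (n k : nat) (B : 'M[A]_n)
    (U : 'M[A]_(n, k)) (V : 'M[A]_(k, n)) (E : 'M[A]_k) :
  B *m U = U *m E ->
  \det (B + U *m V) * \det E = \det B * \det (E + V *m U).
Proof.
(* The determinant of [X] is related to both sides through right multiplication by a block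
   triangular matrix. The first leaves [B + U *m V] above a zero block; in the second product the
   upper right block is [B *m U - U *m E = 0]. *)
move=> BU; pose X := block_mx B (- U) V 1%:M.
have detX : \det X = \det (B + U *m V).
  pose Y : 'M_(n + k) := block_mx 1%:M 0 (- V) 1%:M.
  have detY : \det Y = 1 by rewrite det_lblock !det1 mulr1.
  rewrite -[LHS]mulr1 -detY -det_mulmx.
  rewrite mulmx_block !mulmx1 !mulmx0 !mul1mx subrr.
  by rewrite mulmxN mulNmx opprK !add0r det_ublock det1 mulr1.
pose Y : 'M_(n + k) := block_mx 1%:M U 0 E.
have detY : \det E = \det Y by rewrite det_ublock det1 mul1r.
rewrite -detX detY -det_mulmx mulmx_block.
rewrite !mulmx1 !mulmx0 !addr0 mul1mx mulNmx BU.
by rewrite subrr det_lblock [V *m U + E]addrC.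
Qed.

Lemma sum_mem_natr (A : pzSemiRingType) (T : finType) (B : {set T}) :
  \sum_(i < #|T|) (enum_val i \in B)%:R = #|B|%:R :> A.
Proof.
rewrite -(big_enum_val (fun x : T => (x \in B)%:R)) -sum1_card natr_sum.
by rewrite [RHS]big_mkcond; apply: eq_bigr => x _; case: (x \in B).
Qed.

Lemma prod_if_mem (A : comPzSemiRingType) (T : finType) (Z : {set T}) (a b : A) :
  \prod_(i < #|T|) (if enum_val i \in Z then a else b)
    = a ^+ #|Z| * b ^+ #|~: Z|.
Proof.
rewrite -(big_enum_val (fun x => if x \in Z then a else b)) /=.
rewrite big_if /= !prodr_const; congr (_ ^+ _ * _ ^+ _).
by apply: eq_card => x; rewrite !inE.
Qed.

(** * Determinant for a clique joined to disjoint cliques of equal size *)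

Section BlockDeterminant.
Variables (A : comNzRingType) (T : finType) (Z : {set T}) (P : {set {set T}}).
Variables (m : nat) (a b : A).
Hypothesis partP : partition P (~: Z).
Hypothesis cardP : {in P, forall B : {set T}, #|B| = m}.

Let S : 'M[A]_(#|T|, #|P|) :=
  \matrix_(i, j) (enum_val i \in (enum_val j : {set T}))%:R.
Let D : 'M[A]_#|T| :=
  diag_mx (\row_i if enum_val i \in Z then a else b).

Let mem_cover x : (x \in cover P) = (x \notin Z).
Proof. by rewrite (cover_partition partP) inE. Qed.

(** Off its cover [pblock] defaults to the empty set, so vertices of [Z] give zero rows in
    [S *m S^T]. *)
Let pblockZ x : x \in Z -> pblock P x = set0.
Proof.
move=> xZ; rewrite /pblock; case: pickP => //= B /andP[BP xB].
have : x \in cover P by apply/bigcupP; exists B.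
by rewrite mem_cover xZ.
Qed.

Let pblock_notinZ x y : y \in pblock P x -> y \notin Z.
Proof.
move=> yx; rewrite -mem_cover; apply/bigcupP; exists (pblock P x) => //.
have [/pblockZ xZ|xZ] := boolP (x \in Z); first by rewrite xZ inE in yx.
by rewrite pblock_mem // mem_cover.
Qed.

Let card_pblock x : #|pblock P x| = ((x \notin Z) * m)%N.
Proof.
have [/pblockZ->|xZ] := boolP (x \in Z); first by rewrite cards0.
by rewrite mul1n cardP // pblock_mem // mem_cover.
Qed.

Let mulSS i j : (S *m S^T) i j = (enum_val j \in pblock P (enum_val i))%:R.
Proof.
rewrite !mxE; under eq_bigr => l _ do rewrite !mxE -natrM mulnb.
set x := enum_val i; set y := enum_val j.
rewrite -(big_enum_val (fun B : {set T} => ((x \in B) && (y \in B))%:R)) /=.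
have [xZ|xZ] := boolP (x \in Z).
  rewrite pblockZ // inE big1 // => B BP; case: (boolP (x \in B)) => //= xB.
  have : x \in cover P by apply/bigcupP; exists B.
  by rewrite mem_cover xZ.
have xP : pblock P x \in P by rewrite pblock_mem // mem_cover.
rewrite (bigD1 (pblock P x)) //= big1 ?addr0; last first.
  move=> B /andP[BP]; case: (boolP (x \in B)) => //= xB.
  by rewrite (def_pblock (partition_trivIset partP) BP xB) eqxx.
by rewrite mem_pblock mem_cover xZ.
Qed.

(** The columns of [S] are supported off [Z], where [D] acts as [b], so [det_add_mulmx] applies with
    [E = b%:M]; disjoint blocks of size [m] make [S^T *m S] the scalar [m]. The factor [b ^+ #|P|]
    stays on the left because [b] need not be invertible. *)
Lemma det_disjoint_cliques :
  \det (D + S *m S^T) * b ^+ #|P|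
    = a ^+ #|Z| * b ^+ #|~: Z| * (b + m%:R) ^+ #|P|.
Proof.
have DS : D *m S = S *m b%:M.
  rewrite mul_diag_mx mul_mx_scalar; apply/matrixP=> i j; rewrite !mxE.
  have jP : enum_val j \in P := enum_valP j.
  case: (boolP (enum_val i \in enum_val j)) => [ij|]; last by rewrite !mulr0.
  have : enum_val i \in cover P by apply/bigcupP; exists (enum_val j).
  by rewrite mem_cover => /negPf->.
have SS : S^T *m S = m%:R%:M.
  apply/matrixP=> i j; rewrite !mxE.
  under eq_bigr => l _ do rewrite !mxE -natrM mulnb -in_setI.
  rewrite sum_mem_natr; case: eqVneq => [->|ij].
    by rewrite setIid cardP ?enum_valP.
  have /trivIsetP/(_ _ _ (enum_valP i) (enum_valP j)) := partition_trivIset partP.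
  rewrite (inj_eq enum_val_inj) => /(_ ij).
  by rewrite -setI_eq0 => /eqP->; rewrite cards0.
have := det_add_mulmx S^T DS.
rewrite SS -raddfD !det_scalar det_diag => ->.
by under eq_bigr => i _ do rewrite mxE; rewrite prod_if_mem.
Qed.

Lemma det_join_cliques :
  \det (\matrix_(i < #|T|, j < #|T|)
      let x : T := enum_val i in let y : T := enum_val j in
      (if i == j then if x \in Z then a else b else 0)
        + [|| x \in Z, y \in Z | y \in pblock P x]%:R)
    * (a * (b + m%:R)) * b ^+ #|P|
  = a ^+ #|Z| * b ^+ #|~: Z| * (b + m%:R) ^+ #|P|
    * ((a + #|Z|%:R) * (b + m%:R) - #|Z|%:R * #|~: Z|%:R).
Proof.
(* A row of [U *m V] is all ones for a vertex of [Z] and the indicator of [Z] otherwise, which gives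
   exactly the pairs that meet [Z]. *)
pose U : 'M[A]_(#|T|, 2) :=
  \matrix_(i, j) (if j == 0 then enum_val i \in Z else enum_val i \notin Z)%:R.
pose V : 'M[A]_(2, #|T|) :=
  \matrix_(j, i) (if j == 0 then true else enum_val i \in Z)%:R.
pose E : 'M[A]_2 := diag_mx (\row_j if j == 0 then a else b + m%:R).
(* The indicator of [Z] is killed by [S *m S^T], hence the eigenvalue [a]; on the complement each
   row of [S *m S^T] sums to [m], hence [b + m%:R]. *)
have BU : (D + S *m S^T) *m U = U *m E.
  rewrite mulmxDl mul_diag_mx mul_mx_diag.
  apply/matrixP=> i j; rewrite [LHS]mxE [RHS]mxE !mxE.
  under eq_bigr => l _ do rewrite mulSS mxE -natrM mulnb.
  case: (j == 0).
    rewrite big1 => [|l _]; last first.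
      by have [/pblock_notinZ/negPf->|] := boolP (_ \in pblock _ _).
    by rewrite addr0; case: (_ \in Z); rewrite ?mulr1 ?mul1r ?mulr0 ?mul0r.
  rewrite (eq_bigr (fun l => (enum_val l \in pblock P (enum_val i))%:R)).
    rewrite sum_mem_natr card_pblock natrM.
    by case: (_ \in Z); rewrite /= ?mulr0 ?mul0r ?addr0 ?mulr1 ?mul1r.
  by move=> l _; have [/pblock_notinZ->|] := boolP (_ \in pblock _ _).
have detE : \det E = a * (b + m%:R).
  by rewrite det_diag !big_ord_recl big_ord0 !mxE mulr1.
have detEVU : \det (E + V *m U)
    = (a + #|Z|%:R) * (b + m%:R) - #|Z|%:R * #|~: Z|%:R.
  have VU (j k : 'I_2) : (V *m U) j k
      = \sum_(l < #|T|) ((if j == 0 then true else enum_val l \in Z)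
          && (if k == 0 then enum_val l \in Z else enum_val l \notin Z))%:R.
    by rewrite mxE; apply: eq_bigr => l _; rewrite !mxE -natrM mulnb.
  rewrite det_mx22 ![(E + _) _ _]mxE !VU /= !mxE /= !mulr0n !mulr1n !add0r.
  under [X in _ * (_ + X)]eq_bigr => l _ do rewrite andbN.
  under [X in X * \sum_l _]eq_bigr => l _ do rewrite -in_setC.
  under [X in _ - _ * X]eq_bigr => l _ do rewrite andbb.
  by rewrite !sum_mem_natr sumr_const mul0rn addr0 [#|~: Z|%:R * _]mulrC.
rewrite -detEVU -det_disjoint_cliques [RHS]mulrAC.
rewrite -(det_add_mulmx V BU) detE; congr (\det _ * _ * _).
apply/matrixP=> i j; rewrite [LHS]mxE [RHS]mxE [(D + _) _ _]mxE mulSS !mxE.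
rewrite mulrb -addrA; congr (_ + _).
rewrite !big_ord_recl big_ord0 !mxE /= addr0 mulr1 -natrM mulnb -!natrD.
congr _%:R; have [/pblockZ->|xZ] := boolP (enum_val i \in Z).
  by rewrite inE.
rewrite add0n; case: (boolP (_ \in pblock _ _)) => [/pblock_notinZ/negPf->|] //.
by rewrite orbF.
Qed.
End BlockDeterminant.

Lemma mul_XsubC_div (F : fieldType) (c e : F) :
  c != 0 -> c%:P * ('X - (e / c)%:P) = c%:P * 'X - e%:P.
Proof. by move=> c0; rewrite mulrBr -polyCM mulrCA mulfV ?mulr1. Qed.

(** * Normalized Laplacian spectrum of such a join *)

Section CliqueJoin.
Variables (T : finType) (Gamma : sgraph T) (Z : {set T}) (P : {set {set T}}).
Variable m : nat.
Hypothesis partP : partition P (~: Z).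
Hypothesis cardP : {in P, forall B : {set T}, #|B| = m.+1}.
Hypothesis edgeE : forall x y,
  edge Gamma x y = (x != y) && [|| x \in Z, y \in Z | y \in pblock P x].

Lemma card_join_cliques : #|T| = (#|Z| + #|P| * m.+1)%N.
Proof. by rewrite -(card_uniform_partition cardP partP) cardsC. Qed.

(** A vertex is not its own neighbour: hence the predecessor, and [m] instead of the clique size
    [m.+1]. Off [Z] the neighbours split into [Z] and the rest of the clique. *)
Lemma deg_join_cliques x :
  deg Gamma x = (if x \in Z then #|T|.-1 else #|Z| + m)%N.
Proof.
have [xZ|xZ] := boolP (x \in Z).
  rewrite -cardsT (cardsD1 x) inE add1n /=; apply: eq_card => y.
  by rewrite !inE edgeE xZ /= !andbT eq_sym.
have xP : x \in cover P by rewrite (cover_partition partP) inE.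
have BP : pblock P x \in P by rewrite pblock_mem.
have xx : x \in pblock P x by rewrite mem_pblock.
have := cardP BP; rewrite (cardsD1 x) xx add1n => -[<-].
have dis : Z :&: (pblock P x :\ x) = set0.
  apply/setP=> y; rewrite !inE; apply/negP=> /and3P[yZ _ yx].
  have : y \in cover P by apply/bigcupP; exists (pblock P x).
  by rewrite (cover_partition partP) inE yZ.
rewrite -[RHS]subn0 -(cards0 T) -dis  -cardsU; apply: eq_card => y.
rewrite !inE edgeE (negPf xZ) /= eq_sym; case: (eqVneq y x) => //= ->.
by rewrite (negPf xZ).
Qed.

(** Scaling the characteristic matrix on both sides by the square roots of the degrees yields the
    matrix of [det_join_cliques] over [{poly R}]. The eigenvalues are the roots of [a], [b],
    [b + m.+1%:R] and the quadratic factor. *)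
Lemma spectrum_join_cliques (R : rcfType) :
  (0 < #|Z|)%N -> (0 < #|P|)%N ->
  let N := #|T|%:R : R in let z := #|Z|%:R : R in let d := (#|Z| + m)%:R : R in
  is_spectrum (normalized_laplacian R Gamma)
    ([:: 0; (N - z) / (N - 1) + z / d]
     ++ nseq #|Z|.-1 (N / (N - 1))
     ++ nseq (#|P| * m) ((d + 1) / d)
     ++ nseq #|P|.-1 (z / d)).
Proof.
move=> z_gt0 k_gt0 N z d.
have cT := card_join_cliques.
have d_gt0 : (0 < #|Z| + m)%N by rewrite addn_gt0 z_gt0.
have N1E : N - 1 = #|T|.-1%:R.
  by rewrite /N cT -(prednK z_gt0) addSn /= -natr1 addrK.
have N1_gt0 : (0 < #|T|.-1)%N.
  by rewrite cT -(prednK z_gt0) addSn /= addn_gt0 muln_gt0 k_gt0 orbT.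
have degE := deg_join_cliques.
have deg_gt0 x : (0 < deg Gamma x)%N by rewrite degE; case: ifP.
pose s (i : 'I_#|T|) : R := Num.sqrt (deg Gamma (enum_val i))%:R.
have ss i : s i * s i = (deg Gamma (enum_val i))%:R.
  by rewrite -expr2 sqr_sqrtr ?ler0n.
have s_neq0 i : s i != 0 by rewrite lt0r_neq0 // sqrtr_gt0 ltr0n.
pose Q : 'M[{poly R}]_#|T| := diag_mx (\row_i (s i)%:P).
pose u : {poly R} := (N - 1)%:P; pose v : {poly R} := d%:P.
(* The scaled diagonal entries, degree times ['X - 1], are [a + 1] and [b + 1]; the extra 1 is the
   diagonal of the 0-1 matrix. *)
pose a := u * 'X - N%:P; pose b := v * 'X - (d + 1)%:P.
have QLQ : Q *m char_poly_mx (normalized_laplacian R Gamma) *m Q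
    = \matrix_(i < #|T|, j < #|T|)
        let x : T := enum_val i in let y : T := enum_val j in
        (if i == j then if x \in Z then a else b else 0)
          + [|| x \in Z, y \in Z | y \in pblock P x]%:R.
  rewrite mul_diag_mx mul_mx_diag; apply/matrixP=> i j; rewrite !mxE /=.
  rewrite (inj_eq enum_val_inj) edgeE (inj_eq enum_val_inj).
  case: eqVneq => [<-|ij] /=.
    rewrite -lt0n deg_gt0 mulr1n mulrAC -polyCM ss degE.
    have [xZ|xZ] := boolP (_ \in Z).
      by rewrite -N1E /= /a /u polyCB; ring.
    have xx : enum_val i \in pblock P (enum_val i).
      by rewrite mem_pblock (cover_partition partP) inE.
    by rewrite xx /= -/d /b /v polyCD; ring.
  rewrite mulr0n !add0r; case: ifP => _; last by rewrite polyC0 oppr0 mulr0 mul0r.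
  rewrite polyCN opprK mulrAC -!polyCM sqrtrM ?ler0n // -/(s i) -/(s j).
  by rewrite mul1r mulfV ?mulf_neq0.
have detQ : \det Q * \det Q = u ^+ #|Z| * v ^+ #|~: Z|.
  rewrite det_diag -big_split -prod_if_mem; apply: eq_bigr => i _.
  rewrite !mxE /= -polyCM ss degE.
  by case: ifP => _; rewrite /u /v ?N1E.
have cZ : #|~: Z| = (#|P| * m.+1)%N.
  by rewrite (card_uniform_partition cardP partP).
pose al := 'X - (N / (N - 1))%:P; pose be := 'X - ((d + 1) / d)%:P.
pose ga := 'X - (z / d)%:P.
pose de := 'X - ((N - z) / (N - 1) + z / d)%:P.
have d0 : d != 0 by rewrite pnatr_eq0 -lt0n.
have N10 : N - 1 != 0 by rewrite N1E pnatr_eq0 -lt0n.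
have u0 : u != 0 by rewrite polyC_eq0.
have v0 : v != 0 by rewrite polyC_eq0.
have aE : a = u * al by rewrite mul_XsubC_div.
have bE : b = v * be by rewrite mul_XsubC_div.
have bmE : b + m.+1%:R = v * ga.
  rewrite mul_XsubC_div // /b /d -addrA; congr (_ + _).
  rewrite -polyC_natr -polyCN -polyCD -polyCN; congr _%:P.
  by rewrite -natr1; ring.
(* The constant term is [z * (N - z) - z * (N - z) = 0], which accounts for the eigenvalue 0. *)
have quadE : (a + #|Z|%:R) * (b + m.+1%:R) - #|Z|%:R * #|~: Z|%:R
    = u * v * ('X * de).
  have -> : u * v * ('X * de)
      = 'X * (u * v * 'X - ((N - z) * d + z * (N - 1))%:P).
    rewrite mulrCA /de mulrBr -polyCM; congr (_ * (_ - _)).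
    by rewrite /u /v -!polyCM; congr _%:P; field; rewrite -natrD d0 N10.
  have -> : a + #|Z|%:R = u * 'X - N%:P + z%:P by rewrite -polyC_natr.
  have -> : #|~: Z|%:R = (N - z)%:P :> {poly R}.
    by rewrite -polyC_natr; congr _%:P; rewrite cZ /N cT natrD; ring.
  rewrite bmE mul_XsubC_div // -polyC_natr -/z /u /v.
  by rewrite !(polyCB, polyCD, polyCM); ring.
have := det_join_cliques a b partP cardP.
rewrite -QLQ !det_mulmx [X in X * _ * _ = _ -> _]mulrAC detQ -/(char_poly _).
rewrite quadE bmE aE bE cZ mulnS !exprMn.
rewrite /is_spectrum /= !(big_cat, big_cons) !big_nseq !iter_mulr_1 subr0.
rewrite -/al -/be -/ga -/de.
have al0 : al != 0 by rewrite polyXsubC_eq0.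
have be0 : be != 0 by rewrite polyXsubC_eq0.
have ga0 : ga != 0 by rewrite polyXsubC_eq0.
set chi := char_poly _.
rewrite -(prednK z_gt0) -(prednK k_gt0); set z' := #|Z|.-1; set k := #|P|.-1.
rewrite [be ^+ (k.+1 + _)]exprD [al ^+ z'.+1]exprS [ga ^+ k.+1]exprS /=.
set u1 := u ^+ _; set v1 := v ^+ (_ + _); set v2 := v ^+ _; set be1 := be ^+ k.+1.
(* This is the common factor of both sides of the determinant identity. Cancelling it lowers the
   exponents of [al] and [ga] by one and removes [#|P|] of the factors [be]. *)
have K0 : u1 * v1 * v2 * be1 * (u * v * al * ga) != 0.
  by rewrite !mulf_neq0 // expf_neq0.
clearbody u1 v1 v2 be1 chi al be ga de u v; move=> E.
apply: (mulfI K0).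
transitivity (u1 * v1 * chi * (u * al * (v * ga)) * (v2 * be1)).
  by ring.
move: E; move: (al ^+ z') (be ^+ (k.+1 * m)) (ga ^+ k) => al' be' ga' ->.
by ring.
Qed.
End CliqueJoin.

(** * Centralizers of noncentral elements *)

Section CentralizerOrder.
Variables (gT : finGroupType) (G : {group gT}) (p n : nat).
Hypotheses (p_prime : prime p) (n_ge2 : (2 <= n)%N).
Hypotheses (cardG : #|G| = (p ^ n)%N) (cardZ : #|'Z(G)%g| = (p ^ (n - 2))%N).
Variable x : gT.
Hypotheses (xG : x \in G) (xZ : x \notin 'Z(G)%g).

Let sZC : 'Z(G)%g \subset 'C_G[x]%g.
Proof.
by apply: setIS; rewrite -cent_set1 centS // sub1set.
Qed.

(** The order is a power of [p] strictly between those of the center, which misses [x], and of [G],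
    in which [x] is not central; only one exponent is left. *)
Lemma card_noncentral_centralizer : #|'C_G[x]%g| = (p ^ (n - 1))%N.
Proof.
have p1 := prime_gt1 p_prime.
have xC : x \in 'C_G[x]%g by rewrite subcent1_id.
have /(dvdn_pfactor _ _ p_prime)[e _ eC] : (#|'C_G[x]%g| %| p ^ n)%N.
  by rewrite -cardG cardSg ?subcent1_sub.
have : (#|'Z(G)%g| < #|'C_G[x]%g|)%N.
  by apply/proper_card/properP; split => //; exists x.
have : (#|'C_G[x]%g| < #|G|)%N.
  rewrite proper_card // properE subcent1_sub; apply: contra xZ => /subsetP sGC.
  by apply/centerP; split=> // y /sGC/subcent1P[].
rewrite eC cardG cardZ !ltn_exp2l // => en ne.
by congr (p ^ _)%N; lia.
Qed.

(** Modulo the central subgroup ['Z(G)] the centralizer has prime order, hence is cyclic, and a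
    group that is cyclic modulo a central subgroup is abelian. *)
Lemma noncentral_centralizer_abelian : abelian 'C_G[x]%g.
Proof.
have sZZ : 'Z(G)%g \subset 'Z('C_G[x])%g.
  rewrite subsetI sZC; apply: subset_trans (subsetIr _ _) _.
  by rewrite centS ?subcent1_sub.
apply: (cyclic_factor_abelian sZZ); apply: prime_cyclic.
rewrite card_quotient; last first.
  by rewrite cents_norm // centsC (subset_trans sZZ) ?subsetIr.
rewrite -divgS // card_noncentral_centralizer cardZ.
rewrite -expnB ?prime_gt0 //; last by lia.
by have -> : (n - 1 - (n - 2) = 1)%N by lia.
Qed.
End CentralizerOrder.

(** Carries counts of subsets of [G] over to the vertex type [subg_of G]. *)
Lemma card_sgval_preim (gT : finGroupType) (G : {group gT}) (B : {set gT}) :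
  B \subset G -> #|[set x : subg_of G | sgval x \in B]| = #|B|.
Proof.
move=> sBG; rewrite -(card_imset _ (@subg_inj _ G)); apply: eq_card => x.
apply/imsetP/idP => [[y]|xB]; first by rewrite inE => ? ->.
by exists (subg G x); rewrite ?inE subgK // (subsetP sBG).
Qed.

(** * The commuting graph as a clique join *)

Theorem theorem6p3 (R : rcfType) (gT : finGroupType) (G : {group gT})
    (p n : nat) (p_prime : prime p) (p_odd : odd p) (n_ge2 : (2 <= n)%N)
    (cardG : #|G| = (p ^ n)%N) (cardZ : #|'Z(G)%g| = (p ^ (n - 2))%N) :
  let q : R := p%:R in
  is_spectrum (normalized_laplacian R (commuting_graph G))
    ([:: 0;
         q ^+ n * (q ^+ (n - 1) + q ^+ (n - 2) - q ^+ (n - 3) - 1)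
           / ((q ^+ n - 1) * (q ^+ (n - 1) - 1))]
     ++ nseq (p ^ (n - 2) - 1) (q ^+ n / (q ^+ n - 1))
     ++ nseq (p ^ n - p ^ (n - 2) - p - 1)
          (q ^+ (n - 1) / (q ^+ (n - 1) - 1))
     ++ nseq p (q ^+ (n - 2) / (q ^+ (n - 1) - 1))).
Proof.
move=> q; have p1 := prime_gt1 p_prime; have p0 := prime_gt0 p_prime.
(* For [n = 2] the group would be abelian, yet have a trivial center. Hence [n - 3] is a genuine
   subtraction. *)
have [r nE] : exists r, n = r.+3.
  case: n n_ge2 cardG cardZ => [|[|[|r]]] // _ cG cZ; last by exists r.
  have /center_idP ZG := card_p2group_abelian p_prime cG.
  by have := cZ; rewrite ZG cG => /eqP; rewrite eqn_exp2l.
pose Z := [set x : subg_of G | sgval x \in 'Z(G)%g].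
have ZE x : (x \in Z) = (sgval x \in 'Z(G)%g) by rewrite in_set.
pose rc : rel (subg_of G) := fun x y => (x * y == y * x)%g.
have rcE x y : rc x y = (sgval y \in 'C_G[sgval x]%g).
  rewrite /rc -val_eqE; apply/eqP/subcent1P=> [xy|[_ //]].
  by split; [exact: subgP | exact: xy].
have rc_sym : symmetric rc by move=> x y; rewrite /rc eq_sym.
have rcZ x y : x \in Z -> rc x y.
  rewrite ZE rcE => /centerP[xG xC]; apply/subcent1P.
  by split; [exact: subgP | exact: xC (subgP y)].
have rc_abel x y w : x \notin Z -> rc x y -> rc x w -> rc y w.
  rewrite ZE !rcE => xZ xy xw.
  have /centsP := noncentral_centralizer_abelian p_prime n_ge2 cardG cardZ (subgP x) xZ.
  by move=> /(_ _ xy _ xw) yw; apply/subcent1P; split; rewrite ?subgP.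
(* Restricting to noncentral elements is what makes commuting transitive: two elements that commute
   with such an [x] lie in its abelian centralizer. *)
have rc_eq : {in ~: Z & &, equivalence_rel rc}.
  move=> x y w; rewrite !in_setC => xZ yZ wZ; split; first by rewrite /rc.
  move=> xy; apply/idP/idP=> [|yw]; first exact: rc_abel.
  by apply: (rc_abel y); rewrite // rc_sym.
pose P := equivalence_partition rc (~: Z).
have partP : partition P (~: Z) := equivalence_partitionP rc_eq.
(* Each clique is a centralizer with the center removed; the predecessor fits the clique size
   [m.+1]. *)
pose m := (p ^ (n - 1) - p ^ (n - 2)).-1.
have mE : (m.+1 = p ^ (n - 1) - p ^ (n - 2))%N.
  by rewrite prednK // subn_gt0 ltn_exp2l //; lia.
have cZ : #|Z| = (p ^ (n - 2))%N by rewrite card_sgval_preim ?center_sub.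
have cP : {in P, forall B : {set subg_of G}, #|B| = m.+1}.
  move=> B /imsetP[x]; rewrite in_setC => xZ ->.
  have xZ' : sgval x \notin 'Z(G)%g by rewrite -ZE.
  rewrite mE -(card_noncentral_centralizer p_prime n_ge2 cardG cardZ (subgP x) xZ').
  rewrite -cardZ -cardsDS; last first.
    by apply: setIS; rewrite -cent_set1 centS // sub1set subgP.
  rewrite -(@card_sgval_preim _ G); last first.
    by rewrite (subset_trans (subsetDl _ _)) ?subcent1_sub.
  by apply: eq_card => y; rewrite [LHS]in_set [RHS]in_set in_setC in_setD rcE ZE.
have edgeE x y : edge (commuting_graph G) x y
    = (x != y) && [|| x \in Z, y \in Z | y \in pblock P x].
  rewrite /= /commuting_rel /= -/(rc x y); congr (_ && _).
  have [xZ|xZ] := boolP (x \in Z); first by rewrite rcZ.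
  have [yZ|yZ] := boolP (y \in Z); first by rewrite rc_sym rcZ.
  by rewrite (pblock_equivalence_partition rc_eq) ?in_setC.
have cT : #|{: subg_of G}| = (p ^ n)%N.
  by rewrite -cardG -[RHS](@card_sgval_preim _ G) //; apply: eq_card => y;
    rewrite !in_set subgP.
(* The cliques cover [p ^ n - p ^ (n - 2)] elements, which is [p + 1] times the clique size. *)
have cPk : #|P| = p.+1.
  have := card_join_cliques partP cP.
  rewrite cT cZ => e; apply/eqP; rewrite -(eqn_pmul2r (ltn0Sn m)).
  rewrite -(eqn_add2l (p ^ (n - 2))) -e mE nE !subSS !subn0 !expnS.
  rewrite mulnBr !mulSn; set B := (p * p ^ r)%N.
  (* These bounds ensure that no natural subtraction truncates. *)
  have B1 : (B <= p * B)%N by rewrite leq_pmull.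
  have B2 : (p * B <= p * (p * B))%N by rewrite leq_pmull.
  by apply/eqP; lia.
have pm : (p.+1 * m = p ^ n - p ^ (n - 2) - p - 1)%N.
  have := card_join_cliques partP cP; rewrite cT cZ cPk mulnS => ->.
  by rewrite addKn -subnDA addn1 addKn.
have qX k : (p ^ k)%:R = q ^+ k by rewrite natrX.
have qX1 k : (0 < k)%N -> q ^+ k - 1 != 0.
  by move=> k0; rewrite subr_eq0 -qX pnatr_eq1 -(expn0 p) eqn_exp2l // -lt0n.
have dE : (p ^ (n - 2) + m)%:R = q ^+ (n - 1) - 1 :> R.
  apply/eqP; rewrite eq_sym subr_eq natr1 -addnS mE subnKC ?qX //.
  by rewrite leq_exp2l //; lia.
have := spectrum_join_cliques partP cP edgeE R.
have NE : #|{: subg_of G}|%:R = q ^+ n :> R by rewrite cT qX.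
rewrite NE cZ cPk expn_gt0 p0 => /(_ isT isT).
rewrite /= dE !qX subrK pm !subn1 /=.
(* Only the second eigenvalue still differs in form. Writing [n] as [r.+3] turns the identity into a
   rational one in [q] and [q ^+ r]. *)
suff -> : (q ^+ n - q ^+ (n - 2)) / (q ^+ n - 1) + q ^+ (n - 2) / (q ^+ n.-1 - 1)
    = q ^+ n * (q ^+ n.-1 + q ^+ (n - 2) - q ^+ (n - 3) - 1)
      / ((q ^+ n - 1) * (q ^+ n.-1 - 1)) by [].
have := qX1 n; have := qX1 n.-1; rewrite nE !subSS !subn0 /=.
move=> /(_ isT) h1 /(_ isT) h2; rewrite !exprS in h1 h2 *; field.
by rewrite h1 h2.
Qed.
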